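(* Let $k$ be a field and let $A=A^0\oplus A^1\oplus\cdots$ be a graded $k$-algebra of finite type, with dual graded coalgebra $C=DA$. If $M$ and $N$ are locally finite left and right graded $A$-modules, respectively, then there is a natural isomorphism $$M\square_C N\;\cong\;\operatorname{Hom}_{A^e}(A,M\otimes N).$$
   Context: $\otimes=\otimes_k$; signs follow the usual Koszul convention. Finite type means each $A^n$ is finite-dimensional. Upper and lower indexing are related by $V^n=V_{-n}$. $\operatorname{Hom}^p(V,V')$ is the space of linear maps $f$ with $f(V^i)\subset(V')^{i+p}$ for all $i$; $\operatorname{Hom}(V,V')$ is the graded vector space with these components. The graded dual is $DV=\operatorname{Hom}(V,k)$, so $(DV)_n=(DV)^{-n}=\operatorname{Hom}_k(V^n,k)$; since $A$ is of finite type, $C=DA$ is a graded coassociative coalgebra. A graded module is locally finite if each element generates a finite-dimensional submodule. A locally finite graded left $A$-module $M$ is regarded as a graded right $C$-comodule via $\Delta_M\colon M\to M\otimes DA\subset\operatorname{Hom}(A,M)$, $\Delta_M(m)(a)=am$; similarly for right modules and left comodules. $M\square_CN$ is the kernel of $\Delta_M\otimes1-1\otimes\Delta_N\colon M\otimes N\to M\otimes C\otimes N$. $A^e=A\otimes A^{\mathrm{op}}$; $M\otimes N$ is the graded $A$-bimodule with left action on $M$ and right action on $N$; $\operatorname{Hom}_{A^e}(A,B)$ is the graded vector space whose degree $p$ part consists of the degree $p$ bimodule maps $A\to B$. *)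

(* Defs.v *)
From HB Require Import structures.
From mathcomp Require Import all_boot all_order all_algebra.
From mathcomp Require Import finmap.
From mathcomp Require Import boolp classical_sets functions.
From mathcomp.multinomials Require Import monalg.

Set Implicit Arguments.
Unset Strict Implicit.
Unset Printing Implicit Defensive.

Import GRing.Theory.
Local Open Scope ring_scope.

Reserved Notation "v \ox w" (at level 40, left associativity).


Record submodule (k : fieldType) (V : lmodType k) := Submodule {
  smem :> V -> Prop;
  smem0 : smem 0;
  smem_lin : forall a u v, smem u -> smem v -> smem (a *: u + v) }.

Section SubmoduleType.
Variables (k : fieldType) (V : lmodType k) (P : submodule V).

Definition subm_pred : {pred V} := fun v => `[< P v >].

Lemma subm_predP v : reflect (P v) (v \in subm_pred).
Proof. exact: asboolP. Qed.

Lemma subm_pred_closed : submod_closed subm_pred.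
Proof.
split=> [|a u v /subm_predP Pu /subm_predP Pv]; apply/subm_predP.
  exact: smem0.
exact: smem_lin.
Qed.
HB.instance Definition _ := GRing.isSubmodClosed.Build k V subm_pred
  subm_pred_closed.

Definition subm_type := {v : V | v \in subm_pred}.
HB.instance Definition _ := SubChoice.on subm_type.
HB.instance Definition _ := [SubChoice_isSubLmodule of subm_type by <:].

Definition insubm v (Pv : P v) : subm_type := exist _ v (introT (subm_predP v) Pv).

Lemma subm_typeP (x : subm_type) : P (val x).
Proof. exact/subm_predP/(valP x). Qed.

Definition quotm := Quotient.quot subm_pred.
HB.instance Definition _ := GRing.Zmodule.on quotm.

Definition qpi (v : V) : quotm := (\pi_(Quotient.quot subm_pred) v)%qT.
Definition qrepr (q : quotm) : V := repr (q : Quotient.quot subm_pred).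

Lemma qreprK : cancel qrepr qpi.
Proof. by move=> q; rewrite /qpi /qrepr reprK. Qed.

Lemma qpiD u v : qpi (u + v) = qpi u + qpi v.
Proof. exact: raddfD. Qed.

Lemma qpiP u v : qpi u = qpi v <-> P (u - v).
Proof.
have -> : P (u - v) <-> u - v \in subm_pred by split=> /subm_predP.
by rewrite Quotient.idealrBE; split=> [h|/eqP//]; apply/eqP; exact: h.
Qed.

Definition qscale (a : k) (q : quotm) : quotm := qpi (a *: qrepr q).

Lemma qpiZ a v : qpi (a *: v) = qscale a (qpi v).
Proof.
apply/qpiP; rewrite -scalerBr.
have /qpiP h : qpi v = qpi (qrepr (qpi v)) by rewrite qreprK.
by rewrite -[_ *: _]addr0; apply/smem_lin => //; apply: smem0.
Qed.

Fact qscaleA a b q : qscale a (qscale b q) = qscale (a * b) q.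
Proof. by rewrite -(qreprK q) -!qpiZ scalerA. Qed.
Fact qscale1 : left_id 1 qscale.
Proof. by move=> q; rewrite -(qreprK q) -!qpiZ scale1r. Qed.
Fact qscaleDr : right_distributive qscale +%R.
Proof.
by move=> a p q; rewrite -(qreprK p) -(qreprK q) -!(qpiD, qpiZ) scalerDr.
Qed.
Fact qscaleDl q : {morph qscale^~ q : a b / a + b}.
Proof. by move=> a b; rewrite -(qreprK q) -!qpiZ -qpiD scalerDl. Qed.
HB.instance Definition _ := GRing.Zmodule_isLmodule.Build k quotm
  qscaleA qscale1 qscaleDr qscaleDl.

Fact qpi_is_linear : linear qpi.
Proof. by move=> a u v; rewrite qpiD qpiZ. Qed.
HB.instance Definition _ := GRing.isLinear.Build k V quotm _ qpi qpi_is_linear.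

End SubmoduleType.

Section Span.
Variables (k : fieldType) (V : lmodType k) (S : V -> Prop).

Inductive in_span : V -> Prop :=
| in_span0 : in_span 0
| in_spanD a v w : S v -> in_span w -> in_span (a *: v + w).

Lemma in_span_lin a u v : in_span u -> in_span v -> in_span (a *: u + v).
Proof.
move=> Su Sv; elim: Su => [|b x w Sx _ IHw]; first by rewrite scaler0 add0r.
by rewrite scalerDr scalerA -addrA; apply: in_spanD.
Qed.

Definition span : submodule V := Submodule in_span0 in_span_lin.

Lemma span_gen v : S v -> span v.
Proof.
by move=> Sv; have := in_spanD 1 Sv in_span0; rewrite scale1r addr0.
Qed.

Lemma span_sum I (r : seq I) (F : I -> V) :
  (forall i, span (F i)) -> span (\sum_(i <- r) F i).
Proof.
move=> h; apply: big_rec => [|i x _ Sx]; first exact: in_span0.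
rewrite -[F i]scale1r; exact: in_span_lin (h i) Sx.
Qed.

End Span.

(* A subspace is finite-dimensional when it lies in the span of a finite list *)
Definition findim (k : fieldType) (V : lmodType k) (P : V -> Prop) : Prop :=
  exists s : seq V, forall v, P v -> span (fun x => x \in s) v.


Section Tensor.
Variables (k : fieldType) (V W : lmodType k).

Inductive tens_rel : {malg k[(V * W)%type]} -> Prop :=
| tens_addl u v w : tens_rel (<< (u + v, w) >> - << (u, w) >> - << (v, w) >>)
| tens_addr v w x : tens_rel (<< (v, w + x) >> - << (v, w) >> - << (v, x) >>)
| tens_scalel a v w : tens_rel (<< (a *: v, w) >> - a *: << (v, w) >>)
| tens_scaler a v w : tens_rel (<< (v, a *: w) >> - a *: << (v, w) >>).

Definition tensor := quotm (span tens_rel).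
HB.instance Definition _ := GRing.Lmodule.on tensor.

End Tensor.

HB.lock Definition pure (k : fieldType) (V W : lmodType k) (v : V) (w : W) :
  tensor V W := qpi (span (@tens_rel k V W)) << (v, w) >>.

Notation "v \ox w" := (pure v w) : ring_scope.

Section TensorTheory.
Variables (k : fieldType) (V W : lmodType k).

Lemma tens_relP (x y : {malg k[(V * W)%type]}) :
  tens_rel (x - y) -> qpi (span (@tens_rel k V W)) x = qpi _ y.
Proof. by move=> h; apply/qpiP/span_gen. Qed.

Lemma pureDl u v (w : W) : (u + v : V) \ox w = u \ox w + v \ox w.
Proof.
rewrite !unlock -qpiD; apply: tens_relP; rewrite opprD addrA; exact: tens_addl.
Qed.

Lemma pureDr (v : V) (w x : W) : v \ox (w + x) = v \ox w + v \ox x.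
Proof.
rewrite !unlock -qpiD; apply: tens_relP; rewrite opprD addrA; exact: tens_addr.
Qed.

Lemma pureZl a (v : V) (w : W) : (a *: v) \ox w = a *: (v \ox w).
Proof. rewrite !unlock -linearZ; apply: tens_relP; exact: tens_scalel. Qed.

Lemma pureZr a (v : V) (w : W) : v \ox (a *: w) = a *: (v \ox w).
Proof. rewrite !unlock -linearZ; apply: tens_relP; exact: tens_scaler. Qed.

Lemma pure0l (w : W) : (0 : V) \ox w = 0.
Proof. by rewrite -(scale0r (0 : V)) pureZl scale0r. Qed.

Lemma pure0r (v : V) : v \ox (0 : W) = 0.
Proof. by rewrite -(scale0r (0 : W)) pureZr scale0r. Qed.

Lemma pure_suml I (r : seq I) (F : I -> V) (w : W) :
  (\sum_(i <- r) F i) \ox w = \sum_(i <- r) F i \ox w.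
Proof. by apply: (big_morph (fun v => v \ox w)) => [u v|]; rewrite ?pureDl ?pure0l. Qed.

Lemma pure_sumr I (r : seq I) (v : V) (F : I -> W) :
  v \ox (\sum_(i <- r) F i) = \sum_(i <- r) v \ox F i.
Proof. by apply: (big_morph (fun w => v \ox w)) => [u w|]; rewrite ?pureDr ?pure0r. Qed.

Lemma tensor_sum (t : tensor V W) :
  exists s : seq (V * W), t = \sum_(x <- s) x.1 \ox x.2.
Proof.
rewrite -(qreprK t); set g := qrepr t.
exists [seq (g@_x *: x.1, x.2) | x <- msupp g].
rewrite big_map {1}[g]monalgE raddf_sum; apply: eq_bigr => -[v w] _ /=.
rewrite pureZl !unlock -linearZ; congr (qpi _ _).
by apply/malgP => y; rewrite mcoeffZ !mcoeffU mulrnAr mulr1.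
Qed.

Lemma tensor_ind (P : tensor V W -> Prop) :
  P 0 -> (forall v w t, P t -> P (v \ox w + t)) -> forall t, P t.
Proof.
move=> P0 PD t; have [s ->] := tensor_sum t.
by elim/big_rec: _ => [//|x u _]; apply: PD.
Qed.

Lemma tensor_ext (U : lmodType k) (f g : {linear tensor V W -> U}) :
  (forall v w, f (v \ox w) = g (v \ox w)) -> f =1 g.
Proof.
by move=> e; elim/tensor_ind => [|v w t IH]; rewrite ?linear0 // !linearD e IH.
Qed.

Definition bilin (U : lmodType k) (b : V -> W -> U) : Prop :=
  (forall w, linear (b^~ w)) /\ (forall v, linear (b v)).

Section Lift.
Variables (U : lmodType k) (b : V -> W -> U).

Definition free_ext (g : {malg k[(V * W)%type]}) : U :=
  \sum_(x <- msupp g) g@_x *: b x.1 x.2.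

Lemma free_extw g (d : {fset (V * W)%type}) : (msupp g `<=` d)%fset ->
  free_ext g = \sum_(x <- d) g@_x *: b x.1 x.2.
Proof.
move=> gd; rewrite /free_ext (big_fset_incl _ gd) // => x _ /mcoeff_outdom ->.
by rewrite scale0r.
Qed.

Fact free_ext_linear : linear free_ext.
Proof.
move=> a g h.
have le1 : (msupp (a *: g + h) `<=` msupp g `|` msupp h)%fset.
  apply: (fsubset_trans (msuppD_le _ _)).
  by apply: fsetSU; apply: msuppZ_le.
rewrite (free_extw le1) (free_extw (fsubsetUl (msupp g) (msupp h))).
rewrite (free_extw (fsubsetUr (msupp g) (msupp h))) scaler_sumr -big_split.
by apply: eq_bigr => x _; rewrite mcoeffD mcoeffZ scalerDl scalerA.
Qed.
HB.instance Definition _ := GRing.isLinear.Build k {malg k[(V * W)%type]} U _ free_ext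
  free_ext_linear.

Lemma free_extU v w : free_ext << (v, w) >> = b v w.
Proof.
rewrite (@free_extw _ [fset (v, w)]%fset) ?msuppU_le //.
by rewrite big_seq_fset1 mcoeffUU scale1r.
Qed.

Hypothesis bb : bilin b.

Lemma free_ext_rel x : span (@tens_rel k V W) x -> free_ext x = 0.
Proof.
elim=> [|a y z Ry _ IH]; first by rewrite linear0.
rewrite linearP /= IH addr0; suff -> : free_ext y = 0 by rewrite scaler0.
case: bb => bl br; case: Ry => [u v w|v w w'|c v w|c v w].
- rewrite !linearB /= !free_extU; have := bl w 1 u v.
  by rewrite !scale1r => ->; rewrite addrAC addrK subrr.
- rewrite !linearB /= !free_extU; have := br v 1 w w'.
  by rewrite !scale1r => ->; rewrite addrAC addrK subrr.
- rewrite linearB linearZ /= !free_extU; have := bl w c v 0.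
  have := bl w (-1) 0 0; rewrite !addr0 scaler0 scaleN1r addNr => ->.
  by rewrite addr0 => ->; rewrite subrr.
- rewrite linearB linearZ /= !free_extU; have := br v c w 0.
  have := br v (-1) 0 0; rewrite !addr0 scaler0 scaleN1r addNr => ->.
  by rewrite addr0 => ->; rewrite subrr.
Qed.

Definition tlift_fun (t : tensor V W) : U := free_ext (qrepr t).

Lemma tlift_funE g : tlift_fun (qpi _ g) = free_ext g.
Proof.
apply/eqP; rewrite -subr_eq0 -linearB; apply/eqP/free_ext_rel/qpiP.
by rewrite qreprK.
Qed.

Fact tlift_fun_linear : linear tlift_fun.
Proof.
move=> a s t; rewrite -(qreprK s) -(qreprK t) -linearP !tlift_funE.
exact: linearP.
Qed.

Lemma tlift_ex :
  {f : {linear tensor V W -> U} | forall v w, f (v \ox w) = b v w}.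
Proof.
pose lin := GRing.isLinear.Build k (tensor V W) U _ tlift_fun tlift_fun_linear.
pose f : {linear _ -> _} := HB.pack tlift_fun lin.
by exists f => v w; rewrite unlock /f /= tlift_funE free_extU.
Qed.

Definition tlift : {linear tensor V W -> U} := sval tlift_ex.

Lemma tliftE v w : tlift (v \ox w) = b v w.
Proof. exact: svalP tlift_ex v w. Qed.

End Lift.

End TensorTheory.

Section TensorMaps.
Variable k : fieldType.

Section Map.
Variables (V V' W W' : lmodType k).
Variables (f : {linear V -> V'}) (g : {linear W -> W'}).

Fact tmap_bilin : bilin (fun v w => f v \ox g w).
Proof.
split=> x a u v; first by rewrite linearP pureDl pureZl.
by rewrite linearP pureDr pureZr.
Qed.

Definition tmap : {linear tensor V W -> tensor V' W'} := tlift tmap_bilin.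

Lemma tmapE v w : tmap (v \ox w) = f v \ox g w.
Proof. exact: tliftE. Qed.

End Map.

Section Assoc.
Variables (U V W : lmodType k).

Fact tassoc_bilin1 (u : U) : bilin (fun (v : V) (w : W) => (u \ox v) \ox w).
Proof.
split=> x a y z; first by rewrite pureDr pureZr pureDl pureZl.
by rewrite pureDr pureZr.
Qed.

Fact tassoc_bilin : bilin (fun u t => tlift (tassoc_bilin1 u) t).
Proof.
split=> [t a u u'|u a s t]; last exact: linearP.
have e0 y : tlift (tassoc_bilin1 y) 0 = 0 by exact: linear0.
have eD y v w s : tlift (tassoc_bilin1 y) (v \ox w + s) =
    (y \ox v) \ox w + tlift (tassoc_bilin1 y) s.
  by rewrite [LHS]linearD; congr (_ + _); exact: tliftE.
elim/tensor_ind: t => [|v w t IH]; first by rewrite !e0 scaler0 addr0.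
by rewrite !eD IH !(pureDl, pureZl) scalerDr addrACA.
Qed.

Definition tassoc : {linear tensor U (tensor V W) -> tensor (tensor U V) W} :=
  tlift tassoc_bilin.

Lemma tassocE u v w : tassoc (u \ox (v \ox w)) = (u \ox v) \ox w.
Proof. by rewrite [LHS]tliftE tliftE. Qed.

End Assoc.

Section Swap.
Variables (V W : lmodType k).

Fact tswap_bilin : bilin (fun (v : V) (w : W) => w \ox v).
Proof. by split=> x a u v; rewrite ?(pureDl, pureDr, pureZl, pureZr). Qed.

Definition tswap : {linear tensor V W -> tensor W V} := tlift tswap_bilin.

Lemma tswapE v w : tswap (v \ox w) = w \ox v.
Proof. exact: tliftE. Qed.

End Swap.
End TensorMaps.


(* V = (+)_n V^n: the V^n span V and are independent *)
Record grading (k : fieldType) (V : lmodType k) := Grading {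
  piece :> int -> submodule V;
  grading_span : forall v, span (fun x => exists n, piece n x) v;
  grading_indep : forall (s : seq int) (c : int -> V), uniq s ->
    (forall n, piece n (c n)) -> \sum_(n <- s) c n = 0 ->
    forall n, n \in s -> c n = 0 }.

Lemma big_supp (V : nmodType) (c : int -> V) (s r : seq int) :
  uniq s -> uniq r -> {subset s <= r} -> (forall n, n \notin s -> c n = 0) ->
  \sum_(n <- r) c n = \sum_(n <- s) c n.
Proof.
move=> us ur sr c0; rewrite (bigID (mem s)) /= [X in _ + X]big1 ?addr0 //.
rewrite -big_filter; apply: perm_big; apply: uniq_perm; rewrite ?filter_uniq //.
by move=> x; rewrite mem_filter; case: (boolP (x \in s)) => //= /sr ->.
Qed.

Section GradingTheory.
Variables (k : fieldType) (V : lmodType k) (G : grading V).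

Definition decomp (v : V) (c : int -> V) : Prop :=
  (forall n, G n (c n)) /\ exists s : seq int,
    [/\ uniq s, forall n, n \notin s -> c n = 0 & v = \sum_(n <- s) c n].

Lemma decomp_ex v : exists c, decomp v c.
Proof.
elim: (grading_span G v) => [|a x w [d Gx] _ [c [Gc [s [us c0 ->]]]]].
  exists (fun=> 0); split=> [n|]; first exact: smem0.
  by exists [::]; split=> //; rewrite big_nil.
exists (fun n => (if n == d then a *: x else 0) + c n); split=> [n|].
  rewrite -[X in X + _]scale1r; apply: smem_lin => //.
  case: eqP => [->|_]; last exact: smem0.
  by rewrite -[_ *: _]addr0; apply/smem_lin => //; apply: smem0.
exists (undup (d :: s)); split; first exact: undup_uniq.
  move=> n; rewrite mem_undup inE negb_or => /andP[/negPf -> /c0 ->].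
  by rewrite addr0.
rewrite big_split; congr (_ + _).
  rewrite (bigD1_seq d) ?mem_undup ?mem_head ?undup_uniq //= eqxx.
  by rewrite big1 ?addr0 // => n /negPf ->.
rewrite (big_supp us (undup_uniq _) _ c0) // => n ns.
by rewrite mem_undup inE ns orbT.
Qed.

Lemma decomp_lin a u v c d : decomp u c -> decomp v d ->
  decomp (a *: u + v) (fun n => a *: c n + d n).
Proof.
move=> [Gc [s [us c0 ->]]] [Gd [r [ur d0 ->]]]; split=> [n|].
  exact: smem_lin.
exists (undup (s ++ r)); split; first exact: undup_uniq.
  move=> n; rewrite mem_undup mem_cat negb_or => /andP[/c0 -> /d0 ->].
  by rewrite scaler0 addr0.
rewrite big_split -scaler_sumr.
rewrite (big_supp us (undup_uniq _) _ c0) ?(big_supp ur (undup_uniq _) _ d0) //.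
  by move=> n nr; rewrite mem_undup mem_cat nr orbT.
by move=> n ns; rewrite mem_undup mem_cat ns.
Qed.

Lemma decomp_uniq v c d : decomp v c -> decomp v d -> c =1 d.
Proof.
move=> dc dd n; have := decomp_lin (-1) dc dd.
rewrite scaleN1r addNr => -[Gcd [s [us cd0 /esym/(grading_indep us Gcd) h]]].
have : - c n + d n = 0.
  rewrite -scaleN1r.
  by case: (boolP (n \in s)) => [/h//|]; apply: cd0.
by move/eqP; rewrite addrC subr_eq0 => /eqP.
Qed.

Definition gcomp n v : V := sval (cid (decomp_ex v)) n.

Lemma gcompP v : decomp v (gcomp ^~ v).
Proof. exact: svalP (cid (decomp_ex v)). Qed.

Fact gcomp_linear n : linear (gcomp n).
Proof.
by move=> a u v; apply: (decomp_uniq (gcompP _) (decomp_lin a (gcompP u) (gcompP v))).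
Qed.
HB.instance Definition _ n := GRing.isLinear.Build k V V _ (gcomp n)
  (gcomp_linear n).

Lemma gcomp_piece n v : G n (gcomp n v).
Proof. by case: (gcompP v). Qed.

Lemma gcomp_homog d v n : G d v -> gcomp n v = if n == d then v else 0.
Proof.
move=> Gv; apply: (decomp_uniq (gcompP _) (d := fun n => if n == d then v else 0)).
split=> [m|]; first by case: eqP => [->//|_]; apply: smem0.
exists [:: d]; split=> // [m|]; last by rewrite big_seq1 eqxx.
by rewrite inE => /negPf ->.
Qed.

Lemma piece_eq0 i j v : G i v -> G j v -> i != j -> v = 0.
Proof.
move=> Gi Gj ij; have := gcomp_homog i Gj.
by rewrite (gcomp_homog i Gi) eqxx (negPf ij).
Qed.

End GradingTheory.

Section TensorGrading.
Variables (k : fieldType) (V W : lmodType k) (G : grading V) (H : grading W).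

Definition tensor_piece (n : int) : submodule (tensor V W) :=
  span (fun t => exists i j v w,
    [/\ G i v, H j w, i + j = n & t = v \ox w]).

Fact tensor_grading_span t : span (fun x => exists n, tensor_piece n x) t.
Proof.
elim/tensor_ind: t => [|v w t IH]; first exact: smem0.
rewrite -[X in X + _]scale1r; apply: smem_lin => //.
elim: (grading_span G v) => [|a x v' [i Gx] _ IHv]; first by rewrite pure0l; apply: smem0.
rewrite pureDl pureZl; apply: smem_lin => //.
elim: (grading_span H w) => [|b y w' [j Hy] _ IHw]; first by rewrite pure0r; apply: smem0.
rewrite pureDr pureZr; apply: smem_lin => //.
by apply: span_gen; exists (i + j); apply: span_gen; exists i, j, x, y.
Qed.

(* Truncated projections sum_(i in r) (pi_i ox pi_(n-i)) *)
Definition tproj (r : seq int) (n : int) (t : tensor V W) : tensor V W :=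
  \sum_(i <- r) tmap (gcomp G i) (gcomp H (n - i)) t.

Lemma tproj_lin r n a s t : tproj r n (a *: s + t) = a *: tproj r n s + tproj r n t.
Proof.
rewrite /tproj scaler_sumr -big_split; apply: eq_bigr => i _; exact: linearP.
Qed.

Lemma tproj0 r n : tproj r n 0 = 0.
Proof. by rewrite /tproj big1 // => i _; exact: linear0. Qed.

Lemma tproj_piece n t : tensor_piece n t -> exists s : seq int,
  forall r, uniq r -> {subset s <= r} ->
  forall m, tproj r m t = if m == n then t else 0.
Proof.
elim=> [|a x u [i [j [v [w [Gv Hw <- ->]]]]] _ [s IH]].
  by exists [::] => r _ _ m; rewrite tproj0; case: eqP.
exists (i :: s) => r ur sr m; rewrite tproj_lin IH //; last first.
  by move=> y ys; apply: sr; rewrite inE ys orbT.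
have ir : i \in r by apply: sr; rewrite mem_head.
rewrite [tproj _ _ _](_ : _ = if m == i + j then v \ox w else 0); last first.
  rewrite /tproj (bigD1_seq i) //= [X in _ + X]big1 => [|l li].
    rewrite addr0 tmapE /= (gcomp_homog _ Gv) (gcomp_homog _ Hw) eqxx.
    by rewrite subr_eq addrC; case: eqP => // _; rewrite pure0r.
  by rewrite tmapE /= (gcomp_homog _ Gv) (negPf li) pure0l.
by case: eqP => // _; rewrite scaler0 addr0.
Qed.

Fact tensor_grading_indep (s : seq int) (c : int -> tensor V W) : uniq s ->
    (forall n, tensor_piece n (c n)) -> \sum_(n <- s) c n = 0 ->
    forall n, n \in s -> c n = 0.
Proof.
move=> us Pc c0 n ns.
have [f fP] := choice (fun m => tproj_piece (Pc m)).
pose r := undup (flatten [seq f m | m <- s]).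
have fr m : m \in s -> {subset f m <= r}.
  move=> ms x xf; rewrite mem_undup; apply/flattenP; exists (f m) => //.
  exact: map_f.
have tsum : tproj r n (\sum_(m <- s) c m) = \sum_(m <- s) tproj r n (c m).
  apply: (big_morph (tproj r n)); last exact: tproj0.
  by move=> x y; have := tproj_lin r n 1 x y; rewrite !scale1r.
rewrite -(tproj0 r n) -c0 tsum (bigD1_seq n) //= big1_seq => [|m /andP[mn ms]].
  by rewrite addr0 (fP n _ (undup_uniq _) (fr _ ns)) eqxx.
by rewrite (fP m _ (undup_uniq _) (fr _ ms)) eq_sym (negPf mn).
Qed.

Definition tensor_grading : grading (tensor V W) :=
  Grading tensor_grading_span tensor_grading_indep.

End TensorGrading.

Section GradedHom.
Variables (k : fieldType) (V W : lmodType k) (G : grading V) (H : grading W).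

Definition hom_deg (p : int) (f : V -> W) : Prop :=
  linear f /\ forall i v, G i v -> H (i + p) (f v).

(* (+)_p Hom^p(V, W), realized inside the space of all maps V -> W *)
Definition grHom : submodule (V -> W) := span (fun f => exists p, hom_deg p f).

Lemma grHom_linear f : grHom f -> linear f.
Proof.
elim=> [|a g h [p [lg _]] _ lh] b u v; first by rewrite scaler0 addr0.
rewrite !fctE lg lh.
by rewrite scalerDr scalerDr !scalerA mulrC addrACA.
Qed.

End GradedHom.

Section Base.
Variable k : fieldType.

(* The field k, concentrated in degree 0 *)
Fact base_lin n (a : k) (u v : k^o) :
  n = 0 :> int \/ u = 0 -> n = 0 \/ v = 0 -> n = 0 \/ a *: u + v = 0.
Proof.
by case=> [->|->]; [left|case=> [->|->]; [left|right; rewrite scaler0 addr0]].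
Qed.

Definition base_piece (n : int) : submodule k^o :=
  @Submodule k k^o (fun c => n = 0 \/ c = 0) (or_intror erefl) (@base_lin n).

Fact base_span (c : k^o) : span (fun x => exists n, base_piece n x) c.
Proof. by apply: span_gen; exists 0; left. Qed.

Fact base_indep (s : seq int) (c : int -> k^o) : uniq s ->
  (forall n, base_piece n (c n)) -> \sum_(n <- s) c n = 0 ->
  forall n, n \in s -> c n = 0.
Proof.
move=> us Pc c0 n ns; case: (Pc n) => // n0; move: c0.
rewrite (bigD1_seq n) //= big1 ?addr0 // => m mn.
by case: (Pc m) => // m0; rewrite m0 n0 eqxx in mn.
Qed.

Definition base_grading : grading k^o := Grading base_span base_indep.

End Base.


(* A record rather than an algType, since the latter requires 1 != 0 *)
Record grAlg (k : fieldType) := GrAlg {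
  ga_car :> lmodType k;
  ga_gr : grading ga_car;
  gone : ga_car;
  gmul : ga_car -> ga_car -> ga_car;
  gmul_linl : forall b, linear (gmul^~ b);
  gmul_linr : forall a, linear (gmul a);
  gmulA : associative gmul;
  gmul1l : left_id gone gmul;
  gmul1r : right_id gone gmul;
  gone_deg : ga_gr 0 gone;
  gmul_deg : forall i j a b, ga_gr i a -> ga_gr j b -> ga_gr (i + j) (gmul a b) }.

Definition nonneg_graded (k : fieldType) (A : grAlg k) : Prop :=
  forall (n : int) (a : A), (n < 0)%R -> ga_gr A n a -> a = 0.

Definition finite_type (k : fieldType) (A : grAlg k) : Prop :=
  forall n, findim (ga_gr A n).

Section Modules.
Variables (k : fieldType) (A : grAlg k).

(* Axioms common to left actions (act a v = av) and right ones (act a v = va) *)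
Record is_act (V : lmodType k) (G : grading V) (act : A -> V -> V) : Prop :=
  IsAct {
    act_linl : forall v, linear (act^~ v);
    act_linr : forall a, linear (act a);
    act_one : forall v, act (gone A) v = v;
    act_deg : forall i j a v, ga_gr A i a -> G j v -> G (i + j) (act a v) }.

(* The submodule generated by v is the image of A under a |-> act a v *)
Definition locally_finite (V : lmodType k) (act : A -> V -> V) : Prop :=
  forall v, findim (fun x => exists a, x = act a v).

Record lfLmod := LfLmod {
  lm_car :> lmodType k;
  lm_gr : grading lm_car;
  lact : A -> lm_car -> lm_car;
  lm_act : is_act lm_gr lact;
  lactM : forall a b m, lact (gmul a b) m = lact a (lact b m);
  lm_lf : locally_finite lact }.

Record lfRmod := LfRmod {
  rm_car :> lmodType k;
  rm_gr : grading rm_car;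
  ract : rm_car -> A -> rm_car;
  rm_act : is_act rm_gr (fun a n => ract n a);
  ractM : forall n a b, ract n (gmul a b) = ract (ract n a) b;
  rm_lf : locally_finite (fun a n => ract n a) }.

Record lmodMor (M M' : lfLmod) := LmodMor {
  lmodMor_fun :> {linear M -> M'};
  lmodMor_deg : forall i m, lm_gr M i m -> lm_gr M' i (lmodMor_fun m);
  lmodMor_act : forall a m, lmodMor_fun (lact a m) = lact a (lmodMor_fun m) }.

Record rmodMor (N N' : lfRmod) := RmodMor {
  rmodMor_fun :> {linear N -> N'};
  rmodMor_deg : forall i n, rm_gr N i n -> rm_gr N' i (rmodMor_fun n);
  rmodMor_act : forall n a, rmodMor_fun (ract n a) = ract (rmodMor_fun n) a }.

Record bimod := Bimod {
  bm_car :> lmodType k;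
  bm_gr : grading bm_car;
  blact : A -> bm_car -> bm_car;
  bract : bm_car -> A -> bm_car;
  bm_lact : is_act bm_gr blact;
  bm_ract : is_act bm_gr (fun a x => bract x a);
  blactM : forall a b x, blact (gmul a b) x = blact a (blact b x);
  bractM : forall x a b, bract x (gmul a b) = bract (bract x a) b;
  blractC : forall a x b, bract (blact a x) b = blact a (bract x b) }.

(* A map of degree p moves past a in f (a x b) = (-1)^(p |a|) a f(x) b, whence
   the Koszul sign; this is linearity of degree p over A ox A^op, on which
   (a ox b) x = (-1)^(|b| |x|) a x b *)
Definition is_bimod_hom (B B' : bimod) (p : int) (f : B -> B') : Prop :=
  hom_deg (bm_gr B) (bm_gr B') p f /\
  forall i a x b, ga_gr A i a ->
    f (bract (blact a x) b) = (-1 : k) ^ (p * i) *: bract (blact a (f x)) b.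

Fact bimod_hom0 (B B' : bimod) p : is_bimod_hom p (0 : B -> B').
Proof.
split; first split=> [a u v|i v _]; rewrite ?scaler0 ?addr0 //; first exact: smem0.
move=> i a x b _; have l0 := act_linr (bm_lact B') a (-1) 0 0.
have r0 := act_linr (bm_ract B') b (-1) 0 0.
move: l0 r0; rewrite !scaleN1r !addNr ?oppr0 ?addr0 => l0 r0.
change (0 = (-1 : k) ^ (p * i) *: bract (blact a (0 : B')) b).
by rewrite l0 r0 scaler0.
Qed.

Fact bimod_hom_lin (B B' : bimod) p a (f g : B -> B') :
  is_bimod_hom p f -> is_bimod_hom p g -> is_bimod_hom p (a *: f + g).
Proof.
move=> [[lf df] hf] [[lg dg] hg]; split; first split=> [b u v|i v Gv].
- by rewrite !fctE lf lg !scalerDr !scalerA mulrC addrACA.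
- by apply: smem_lin; [apply: df|apply: dg].
move=> i b x c Ab; rewrite !fctE (hf _ _ _ _ Ab) (hg _ _ _ _ Ab).
rewrite (act_linr (bm_lact B')) (act_linr (bm_ract B') c).
by rewrite scalerDr !scalerA mulrC.
Qed.

Definition bimod_hom (B B' : bimod) (p : int) : submodule (B -> B') :=
  Submodule (@bimod_hom0 B B' p) (@bimod_hom_lin B B' p).

(* Degree 0 bimodule maps *)
Record bimodMor (B B' : bimod) := BimodMor {
  bimodMor_fun :> {linear B -> B'};
  bimodMor_deg : forall i x, bm_gr B i x -> bm_gr B' i (bimodMor_fun x);
  bimodMor_lact : forall a x, bimodMor_fun (blact a x) = blact a (bimodMor_fun x);
  bimodMor_ract : forall x a, bimodMor_fun (bract x a) = bract (bimodMor_fun x) a }.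

Fact bimod_hom_comp (B B' B'' : bimod) (g : bimodMor B' B'') p (f : B -> B') :
  bimod_hom B B' p f -> bimod_hom B B'' p (g \o f).
Proof.
move=> [[lf df] hf]; split; first split=> [a u v|i v Gv] /=.
- by rewrite lf linearP.
- by apply: bimodMor_deg; apply: df.
move=> i a x b Aa /=; rewrite (hf _ _ _ _ Aa) linearZ /=.
by rewrite bimodMor_ract bimodMor_lact.
Qed.

Definition bimod_hom_map (B B' B'' : bimod) (g : bimodMor B' B'') p
    (f : subm_type (bimod_hom B B' p)) : subm_type (bimod_hom B B'' p) :=
  insubm (bimod_hom_comp g (subm_typeP f)).

Fact reg_lact : is_act (ga_gr A) (@gmul k A).
Proof.
split; [exact: gmul_linl|exact: gmul_linr|exact: gmul1l|exact: gmul_deg].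
Qed.

Fact reg_ract : is_act (ga_gr A) (fun a x : A => gmul x a).
Proof.
split; [exact: gmul_linr|exact: gmul_linl|exact: gmul1r|].
by move=> i j a v Aa Av; rewrite addrC; apply: gmul_deg.
Qed.

Definition regular : bimod :=
  @Bimod A (ga_gr A) (@gmul k A) (@gmul k A) reg_lact reg_ract
    (fun a b x => esym (gmulA a b x)) (fun x a b => gmulA x a b)
    (fun a x b => esym (gmulA a x b)).

Section TensorBimod.
Variables (M : lfLmod) (N : lfRmod).

HB.instance Definition _ a := GRing.isLinear.Build k M M _ (@lact M a)
  (act_linr (lm_act M) a).
Definition ractr (a : A) (n : N) : N := ract n a.
HB.instance Definition _ a := GRing.isLinear.Build k N N _ (ractr a)
  (act_linr (rm_act N) a).

Definition tlact (a : A) : tensor M N -> tensor M N := tmap (lact a) idfun.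
Definition tract (t : tensor M N) (a : A) : tensor M N :=
  tmap idfun (ractr a) t.

Lemma tlactE a m n : tlact a (m \ox n) = lact a m \ox n.
Proof. exact: tmapE. Qed.
Lemma tractE a m n : tract (m \ox n) a = m \ox ract n a.
Proof. exact: tmapE. Qed.

Lemma tlactD a s t : tlact a (s + t) = tlact a s + tlact a t.
Proof. exact: linearD. Qed.
Lemma tractD a s t : tract (s + t) a = tract s a + tract t a.
Proof. exact: linearD. Qed.
Lemma tlact0 a : tlact a 0 = 0.
Proof. exact: linear0. Qed.
Lemma tract0 a : tract 0 a = 0.
Proof. exact: linear0. Qed.

Fact tlact_is_act : is_act (tensor_grading (lm_gr M) (rm_gr N)) tlact.
Proof.
split=> [t a b c|a b s t|t|i j a t Aa].
- elim/tensor_ind: t => [|m n t IH]; first by rewrite !tlact0 scaler0 addr0.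
  rewrite !tlactD IH !tlactE (act_linl (lm_act M)) pureDl pureZl scalerDr.
  by rewrite addrACA.
- exact: linearP.
- elim/tensor_ind: t => [|m n t IH]; first by rewrite tlact0.
  by rewrite tlactD tlactE IH (act_one (lm_act M)).
elim=> [|b x t' [i' [j' [m [n [Mm Nn <- ->]]]]] _ IH].
  by rewrite tlact0; apply: smem0.
rewrite [tlact _ _]linearP; apply: smem_lin => //; apply: span_gen.
exists (i + i'), j', (lact a m), n; split=> //; last exact: tlactE.
  exact: act_deg (lm_act M) _ _ _ _ Aa Mm.
by rewrite addrA.
Qed.

Fact tract_is_act :
  is_act (tensor_grading (lm_gr M) (rm_gr N)) (fun a t => tract t a).
Proof.
split=> [t a b c|a b s t|t|i j a t Aa].
- elim/tensor_ind: t => [|m n t IH]; first by rewrite !tract0 scaler0 addr0.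
  rewrite !tractD IH !tractE (act_linl (rm_act N)) pureDr pureZr scalerDr.
  by rewrite addrACA.
- exact: linearP.
- elim/tensor_ind: t => [|m n t IH]; first by rewrite tract0.
  by rewrite tractD tractE IH (act_one (rm_act N)).
elim=> [|b x t' [i' [j' [m [n [Mm Nn <- ->]]]]] _ IH].
  by rewrite tract0; apply: smem0.
rewrite [tract _ _]linearP; apply: smem_lin => //; apply: span_gen.
exists i', (i + j'), m, (ract n a); split=> //; last exact: tractE.
  exact: act_deg (rm_act N) _ _ _ _ Aa Nn.
by rewrite addrCA.
Qed.

Fact tlactM a b t : tlact (gmul a b) t = tlact a (tlact b t).
Proof.
elim/tensor_ind: t => [|m n t IH]; first by rewrite !tlact0.
by rewrite !tlactD !tlactE IH lactM.
Qed.

Fact tractM t a b : tract t (gmul a b) = tract (tract t a) b.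
Proof.
elim/tensor_ind: t => [|m n t IH]; first by rewrite !tract0.
by rewrite !tractD !tractE IH ractM.
Qed.

Fact tlractC a t b : tract (tlact a t) b = tlact a (tract t b).
Proof.
elim/tensor_ind: t => [|m n t IH]; first by rewrite !(tlact0, tract0).
by rewrite !(tlactD, tractD) IH !(tlactE, tractE).
Qed.

Definition tensor_bimod : bimod :=
  Bimod tlact_is_act tract_is_act tlactM tractM tlractC.

End TensorBimod.

Section TensorBmor.
Variables (M M' : lfLmod) (N N' : lfRmod) (f : lmodMor M M') (g : rmodMor N N').

Let fg : {linear tensor_bimod M N -> tensor_bimod M' N'} := tmap f g.

Let fgD s t : fg (s + t) = fg s + fg t. Proof. exact: linearD. Qed.
Let fg0 : fg 0 = 0. Proof. exact: linear0. Qed.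
Let fgE m n : fg (m \ox n) = f m \ox g n. Proof. exact: tmapE. Qed.

Fact tensor_bimodMor_deg i x :
  bm_gr (tensor_bimod M N) i x -> bm_gr (tensor_bimod M' N') i (fg x).
Proof.
elim=> [|b y t' [i' [j' [m [n [Mm Nn <- ->]]]]] _ IH].
  by rewrite fg0; apply: smem0.
rewrite [fg _]linearP; apply: smem_lin => //; apply: span_gen.
exists i', j', (f m), (g n); split; [exact: lmodMor_deg|exact: rmodMor_deg|by []|].
exact: fgE.
Qed.

Fact tensor_bimodMor_lact a x :
  fg (@blact (tensor_bimod M N) a x) = @blact (tensor_bimod M' N') a (fg x).
Proof.
rewrite /=; elim/tensor_ind: x => [|m n t IH]; first by rewrite tlact0 fg0 tlact0.
by rewrite tlactD !fgD tlactD IH tlactE !fgE tlactE lmodMor_act.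
Qed.

Fact tensor_bimodMor_ract x a :
  fg (@bract (tensor_bimod M N) x a) = @bract (tensor_bimod M' N') (fg x) a.
Proof.
rewrite /=; elim/tensor_ind: x => [|m n t IH]; first by rewrite tract0 fg0 tract0.
by rewrite tractD !fgD tractD IH tractE !fgE tractE rmodMor_act.
Qed.

Definition tensor_bimodMor : bimodMor (tensor_bimod M N) (tensor_bimod M' N') :=
  @BimodMor (tensor_bimod M N) (tensor_bimod M' N') (tmap f g)
    tensor_bimodMor_deg tensor_bimodMor_lact tensor_bimodMor_ract.

End TensorBmor.
End Modules.


Section Dual.
Variables (k : fieldType) (A : grAlg k).

(* D A = Hom(A, k), the graded dual *)
Definition dual : lmodType k := subm_type (grHom (ga_gr A) (base_grading k)).

Definition dual_fun (f : dual) (a : A) : k := val f a.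

Lemma dualP (f g : dual) : dual_fun f =1 dual_fun g -> f = g.
Proof. by move=> e; apply/val_inj/funext. Qed.

Lemma dual_funP c (f g : dual) a :
  dual_fun (c *: f + g) a = c * dual_fun f a + dual_fun g a.
Proof. by []. Qed.

Lemma dual_linear (f : dual) c a b :
  dual_fun f (c *: a + b) = c * dual_fun f a + dual_fun f b.
Proof. exact: (grHom_linear (subm_typeP f)). Qed.

Lemma mem_dual (f : A -> k^o) (s : seq int) : linear f ->
  (forall i a, i \notin s -> ga_gr A i a -> f a = 0) ->
  grHom (ga_gr A) (base_grading k) f.
Proof.
move=> lf f0.
pose lin := GRing.isLinear.Build k A k^o _ f lf.
pose F : {linear A -> k^o} := HB.pack f lin.
have fsum (r : seq int) (c : int -> A) :
  f (\sum_(i <- r) c i) = \sum_(i <- r) f (c i) by exact: (raddf_sum F).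
have -> : f = \sum_(i <- undup s) (fun a => f (gcomp (ga_gr A) i a)).
  apply/funext => a; rewrite fct_sumE.
  have [Ga [r [ur r0 ea]]] := gcompP (ga_gr A) a.
  have u1 := undup_uniq (s ++ r); rewrite {1}ea.
  rewrite fsum.
  rewrite -(big_supp ur u1) => [|n nr|n /r0 ->].
  - apply: (big_supp (undup_uniq s) u1) => n.
      by rewrite !mem_undup mem_cat => ->.
    by rewrite mem_undup => /f0; apply.
  - by rewrite mem_undup mem_cat nr orbT.
  - exact: (linear0 F).
apply: span_sum => i; apply: span_gen; exists (- i); split.
  by move=> c u v; rewrite linearP lf.
move=> j v Gv; rewrite (gcomp_homog _ Gv).
case: eqP => [->|_]; first by left; rewrite subrr.
by right; exact: (linear0 F).
Qed.

Section Eval.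
Variable V : lmodType k.

Fact evalr_bilin : bilin (fun (v : V) (f : dual) => fun a : A => dual_fun f a *: v).
Proof.
split=> [f c u v|v c f g]; apply/funext => a; rewrite !fctE.
  by rewrite scalerDr !scalerA mulrC.
by rewrite dual_funP scalerDl scalerA.
Qed.

Fact evall_bilin : bilin (fun (f : dual) (v : V) => fun a : A => dual_fun f a *: v).
Proof.
by split=> [x|x]; [exact: evalr_bilin.2|exact: evalr_bilin.1].
Qed.

(* The inclusions V ox DA <= Hom(A, V) and DA ox V <= Hom(A, V) both carry no
   sign: (v ox f)(a) = (f ox v)(a) = f(a) v. Then the coactions given by
   Delta_M(m)(a) = am and Delta_N(n)(a) = na are coassociative for one and
   the same coproduct on DA, the dual Delta(f)(a ox b) = f(ab) of the product
   of A with (f ox g)(a ox b) = f(a) g(b). A Koszul sign in only one of the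
   two inclusions would break this *)
Definition evalr : {linear tensor V dual -> (A -> V)} := tlift evalr_bilin.
Definition evall : {linear tensor dual V -> (A -> V)} := tlift evall_bilin.

Lemma evalrE v f a : evalr (v \ox f) a = dual_fun f a *: v.
Proof. by rewrite /evalr tliftE. Qed.

Lemma evallE f v a : evall (f \ox v) a = dual_fun f a *: v.
Proof. by rewrite /evall tliftE. Qed.

Lemma evalr_sum0 n (s : seq (V * dual)%type) : (size s <= n)%N ->
  (forall a, \sum_(x <- s) dual_fun x.2 a *: x.1 = 0) ->
  \sum_(x <- s) x.1 \ox x.2 = 0.
Proof.
elim: n s => [|n IH] [|[v f] s] //= sn h; rewrite ?big_nil //.
have [f0|/existsNP[a fa]] := pselect (forall a, dual_fun f a = 0).
  have -> : f = 0 by apply: dualP => a; rewrite f0.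
  rewrite big_cons pure0r add0r; apply: IH => // a.
  by have := h a; rewrite big_cons /= f0 scale0r add0r.
have /eqP fan : dual_fun f a != 0 by apply/eqP.
pose l (x : (V * dual)%type) := - (dual_fun x.2 a / dual_fun f a).
have ve : v = \sum_(x <- s) l x *: x.1.
  have := h a; rewrite big_cons /= => /eqP; rewrite addr_eq0 => /eqP ea.
  apply: (@scalerI _ _ (dual_fun f a)); first by apply/eqP.
  rewrite ea scaler_sumr -sumrN; apply: eq_bigr => x _.
  by rewrite /l scalerA mulrN mulrCA mulfV ?mulr1 ?scaleNr //; apply/eqP.
pose s' := [seq (x.1, l x *: f + x.2) | x <- s].
have es : \sum_(x <- (v, f) :: s) x.1 \ox x.2 = \sum_(x <- s') x.1 \ox x.2.
  rewrite big_cons big_map /= ve pure_suml -big_split; apply: eq_bigr => x _.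
  by rewrite /= pureDr pureZr pureZl.
rewrite es; apply: IH; first by rewrite size_map.
move=> b; rewrite -[RHS](h b) big_cons big_map /= ve scaler_sumr -big_split.
by apply: eq_bigr => x _ /=; rewrite dual_funP scalerDl scalerA mulrC.
Qed.

Lemma evalr_inj : injective evalr.
Proof.
move=> t u /eqP; rewrite -subr_eq0 -linearB => /eqP e; apply/eqP.
rewrite -subr_eq0; apply/eqP; move: e.
have [s ->] := tensor_sum (t - u) => e; apply: (evalr_sum0 (leqnn _)) => a.
transitivity (evalr (\sum_(x <- s) x.1 \ox x.2) a); last by rewrite e.
rewrite raddf_sum fct_sumE.
by apply: eq_bigr => x _; rewrite [RHS]evalrE.
Qed.

Lemma evall_swap t : evall t = evalr (tswap _ _ t).
Proof.
elim/tensor_ind: t => [|f v t IH]; first by rewrite !linear0.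
rewrite !linearD tswapE IH; congr (_ + _).
by apply/funext => a; rewrite evallE evalrE.
Qed.

Lemma evall_inj : injective evall.
Proof.
move=> t u; rewrite !evall_swap => /evalr_inj e.
have K : forall x, tswap _ _ (tswap dual V x) = x.
  by elim/tensor_ind => [|f v x IH]; rewrite ?linear0 // !linearD !tswapE IH.
by rewrite -(K t) e K.
Qed.

(* Maps A -> V of finite rank vanishing in almost all degrees come from V ox DA *)
Lemma evalr_onto (s : seq int) (e : seq V) (L : A -> V) : linear L ->
  (forall a, span (fun x => x \in e) (L a)) ->
  (forall i a, i \notin s -> ga_gr A i a -> L a = 0) ->
  exists t, evalr t = L.
Proof.
elim: e L => [|x e IH] L lL Le L0.
  exists 0; rewrite linear0; apply/funext => a.
  by case: (Le a) => // c v w; rewrite in_nil.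
pose E := span (fun y => y \in e).
have Ex v : span (fun y => y \in x :: e) v -> exists c, E (v - c *: x).
  elim=> [|c y w]; first by exists 0; rewrite scale0r subr0; apply: smem0.
  rewrite inE => /orP[/eqP -> _ [d Ed]|ye _ [d Ed]].
    by exists (c + d); rewrite scalerDl opprD addrACA subrr add0r.
  by exists d; rewrite -addrA; apply: smem_lin => //; apply: span_gen.
have [xE|xE] := pselect (E x).
  apply: IH => // a; have [c Ec] := Ex _ (Le a).
  by rewrite -[L a](subrK (c *: x)) addrC; apply: smem_lin.
have c0 c : E (c *: x) -> c = 0.
  move=> Ec; apply/eqP/negPn/negP => cn; apply: xE.
  rewrite -[x]addr0 -[x]scale1r -(mulVf cn) -scalerA.
  by apply: smem_lin => //; apply: smem0.
have [c cP] := choice (fun a => Ex _ (Le a)).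
have lc : linear (c : A -> k^o).
  move=> b u v; apply/eqP; rewrite -subr_eq0; apply/eqP/c0.
  have h := smem_lin (-1) (cP (b *: u + v)) (smem_lin b (cP u) (cP v)).
  suff -> : (c (b *: u + v) - (b * c u + c v)) *: x =
    (-1) *: (L (b *: u + v) - c (b *: u + v) *: x) +
    (b *: (L u - c u *: x) + (L v - c v *: x)) by [].
  rewrite lL scaleN1r opprB scalerBl scalerDl scalerBr scalerA.
  by rewrite [X in _ = _ + X]addrACA -opprD addrA subrK.
have c0s i a : i \notin s -> ga_gr A i a -> c a = 0.
  move=> si Aa; apply: c0; have := cP a.
  rewrite (L0 _ _ si Aa) add0r => h.
  by have := smem_lin (-1) h (smem0 E); rewrite scaleN1r opprK addr0.
pose C : dual := insubm (mem_dual lc c0s).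
have [t tP] : exists t, evalr t = (fun a => L a - c a *: x).
  apply: IH => [b u v|a|i a si Aa]; last 2 first.
  - exact: cP.
  - by rewrite (L0 _ _ si Aa) (c0s _ _ si Aa) scale0r subr0.
  rewrite lL lc scalerDl scalerBr scalerA opprD addrACA.
  by [].
exists (t + x \ox C); rewrite linearD tP; apply/funext => a.
by rewrite fctE evalrE subrK.
Qed.

End Eval.

Section Coaction.
Variables (V : lmodType k) (G : grading V) (act : A -> V -> V).
Hypotheses (actP : is_act G act) (lf : locally_finite act).

Lemma span_supp (e : seq V) : exists s : seq int,
  forall v, span (fun x => x \in e) v -> forall i, i \notin s -> gcomp G i v = 0.
Proof.
elim: e => [|x e [s IH]].
  exists [::] => v; case=> [|c y w]; last by rewrite in_nil.
  by move=> i _; exact: linear0.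
have [_ [r [_ r0 _]]] := gcompP G x.
exists (r ++ s) => v; elim=> [|c y w]; first by move=> i _; exact: linear0.
move=> ye _ IHw i irs; rewrite linearP /= IHw // addr0.
move: irs; rewrite mem_cat negb_or => /andP[ir is_].
move: ye; rewrite inE => /orP[/eqP ->|ye]; first by rewrite r0 // scaler0.
by rewrite (IH y) ?scaler0 //; apply: span_gen.
Qed.

Lemma coact_ex v : exists t, evalr V t = act^~ v.
Proof.
elim: (grading_span G v) => [|c x w [d Gx] _ [t tP]].
  exists 0; rewrite linear0; apply/funext => a.
  have := act_linr actP a (-1) 0 0.
  by rewrite !scaleN1r !addNr => ->.
have [e eP] := lf x.
have [s sP] := span_supp e.
have [u uP] : exists u, evalr V u = act^~ x.
  apply: (@evalr_onto V [seq j - d | j <- s] e).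
  - exact: act_linl actP x.
  - by move=> a; apply: eP; exists a.
  move=> i a isd Aa; have Gax := act_deg actP Aa Gx.
  have h : i + d \notin s.
    apply: contra isd => h; apply/mapP; exists (i + d) => //.
    by rewrite addrK.
  rewrite -(sP (act a x) _ _ h); last by apply: eP; exists a.
  by rewrite (gcomp_homog _ Gax) eqxx.
exists (c *: u + t); rewrite linearP uP tP; apply/funext => a.
by rewrite (act_linr actP).
Qed.

Lemma coactr_sig :
  {f : {linear V -> tensor V dual} | forall v, evalr V (f v) = act^~ v}.
Proof.
pose f v := sval (cid (coact_ex v)).
have fP v : evalr V (f v) = act^~ v by exact: svalP (cid (coact_ex v)).
have lf' : linear f.
  move=> c u v; apply: evalr_inj; rewrite linearP !fP; apply/funext => a.
  by rewrite (act_linr actP).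
pose lin := GRing.isLinear.Build k V (tensor V dual) _ f lf'.
pose F : {linear V -> tensor V dual} := HB.pack f lin.
by exists F.
Qed.

Lemma coactl_sig :
  {f : {linear V -> tensor dual V} | forall v, evall V (f v) = act^~ v}.
Proof.
have [f fP] := coactr_sig.
exists (tswap V dual \o f) => v; rewrite /= evall_swap -(fP v); congr (evalr V _).
elim/tensor_ind: (f v) => [|x g t IH]; first by rewrite !linear0.
by rewrite !linearD !tswapE IH.
Qed.

End Coaction.

(* Delta_M : M -> M ox DA, the map with Delta_M(m)(a) = am *)
Definition coactr (M : lfLmod A) : {linear M -> tensor M dual} :=
  sval (coactr_sig (lm_act M) (@lm_lf _ _ M)).

(* Delta_N : N -> DA ox N, the map with Delta_N(n)(a) = na *)
Definition coactl (N : lfRmod A) : {linear N -> tensor dual N} :=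
  sval (coactl_sig (rm_act N) (@rm_lf _ _ N)).

Lemma coactrE (M : lfLmod A) m a : evalr M (coactr M m) a = lact a m.
Proof. by rewrite (svalP (coactr_sig (lm_act M) (@lm_lf _ _ M)) m). Qed.

Lemma coactlE (N : lfRmod A) n a : evall N (coactl N n) a = ract n a.
Proof. by rewrite (svalP (coactl_sig (rm_act N) (@rm_lf _ _ N)) n). Qed.

(* Delta_M ox 1 - 1 ox Delta_N, with values in M ox DA ox N *)
Definition cotensor_map (M : lfLmod A) (N : lfRmod A) (x : tensor M N) :
    tensor (tensor M dual) N :=
  tmap (coactr M) idfun x - tassoc M dual N (tmap idfun (coactl N) x).

Fact cotensor0 (M : lfLmod A) (N : lfRmod A) p :
  tensor_grading (lm_gr M) (rm_gr N) p 0 /\ @cotensor_map M N 0 = 0.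
Proof. by split; [exact: smem0|rewrite /cotensor_map !linear0 ?oppr0 addr0]. Qed.

Fact cotensor_lin (M : lfLmod A) (N : lfRmod A) p a x y :
  tensor_grading (lm_gr M) (rm_gr N) p x /\ @cotensor_map M N x = 0 ->
  tensor_grading (lm_gr M) (rm_gr N) p y /\ @cotensor_map M N y = 0 ->
  tensor_grading (lm_gr M) (rm_gr N) p (a *: x + y) /\
    @cotensor_map M N (a *: x + y) = 0.
Proof.
move=> [px /eqP]; rewrite subr_eq0 => /eqP ex [py /eqP].
rewrite subr_eq0 => /eqP ey; split; first exact: smem_lin.
rewrite /cotensor_map [tmap (coactr M) _ _]linearP /= ex ey.
by rewrite [tmap _ (coactl N) (_ + _)]linearP [tassoc _ _ _ (_ + _)]linearP subrr.
Qed.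

(* The degree p part of the kernel of cotensor_map; as both coactions have
   degree 0, these parts make up the whole kernel *)
Definition cotensor (M : lfLmod A) (N : lfRmod A) (p : int) :
    submodule (tensor M N) :=
  @Submodule _ _ (fun x =>
    tensor_grading (lm_gr M) (rm_gr N) p x /\ cotensor_map x = 0)
    (@cotensor0 M N p) (@cotensor_lin M N p).

Section Functoriality.
Variables (M M' : lfLmod A) (N N' : lfRmod A) (f : lmodMor M M') (g : rmodMor N N').

Lemma coactr_nat m : coactr M' (f m) = tmap f idfun (coactr M m).
Proof.
apply: evalr_inj; apply/funext => a; rewrite coactrE -lmodMor_act -coactrE.
elim/tensor_ind: (coactr M m) => [|x c t IH].
  by rewrite !linear0.
rewrite !linearD tmapE !fctE IH; congr (_ + _).
by rewrite [in RHS]evalrE evalrE linearZ.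
Qed.

Lemma coactl_nat n : coactl N' (g n) = tmap idfun g (coactl N n).
Proof.
apply: evall_inj; apply/funext => a; rewrite coactlE -rmodMor_act -coactlE.
elim/tensor_ind: (coactl N n) => [|c x t IH].
  by rewrite !linear0.
rewrite !linearD tmapE !fctE IH; congr (_ + _).
by rewrite [in RHS]evallE evallE linearZ.
Qed.

Lemma cotensor_map_nat x :
  cotensor_map (tmap f g x) = tmap (tmap f idfun) g (cotensor_map x).
Proof.
have assoc_nat : forall t : tensor M (tensor dual N),
    tassoc M' dual N' (tmap f (tmap idfun g) t) =
    tmap (tmap f idfun) g (tassoc M dual N t).
  elim/tensor_ind => [|m t s IH]; first by rewrite !linear0.
  rewrite !linearD IH; congr (_ + _); rewrite tmapE.
  elim/tensor_ind: t => [|c n t IHt]; first by rewrite linear0 !pure0r !linear0.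
  by rewrite linearD !pureDr !linearD IHt tmapE !tassocE !tmapE.
rewrite /cotensor_map linearB -assoc_nat; congr (_ - tassoc _ _ _ _).
  elim/tensor_ind: x => [|m n t IH]; first by rewrite !linear0.
  by rewrite !linearD IH !tmapE coactr_nat.
elim/tensor_ind: x => [|m n t IH]; first by rewrite !linear0.
by rewrite !linearD IH !tmapE coactl_nat.
Qed.

Fact cotensor_mor_proof p x : cotensor M N p x -> cotensor M' N' p (tmap f g x).
Proof.
move=> [px cx]; split; first exact: (tensor_bimodMor_deg f g px).
by rewrite cotensor_map_nat cx linear0.
Qed.

Definition cotensor_mor p (x : subm_type (cotensor M N p)) :
    subm_type (cotensor M' N' p) :=
  insubm (cotensor_mor_proof (subm_typeP x)).

End Functoriality.
End Dual.

(* Main.v *)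
Require Import Defs.
From HB Require Import structures.
From mathcomp Require Import all_boot all_order all_algebra.
From mathcomp Require Import boolp functions.
Set Implicit Arguments.
Unset Strict Implicit.
Unset Printing Implicit Defensive.

Import GRing.Theory.
Local Open Scope ring_scope.

(** Evaluating the middle factor of [M ox DA ox N] at the elements of [A] is
    injective, so [x] lies in the cotensor product iff [a x = x a] for all [a].
    On the other hand a bimodule map [f : A -> M ox N] of degree [p] is
    determined by [y = f 1], the condition on [y] being
    [y a = (-1)^(p |a|) a y]. The involution [m ox n |-> (-1)^(p |m|) m ox n]
    exchanges the two conditions. *)

(** * Scaling a graded space degree by degree *)

Section Rescale.
Variables (k : fieldType) (V : lmodType k) (G : grading V) (c : int -> k).

(** The sum runs over one chosen finite support; by [rescale_funE] any other gives the same value,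
    so linearity can be checked on a common one. *)
Definition rescale_fun (v : V) : V :=
  \sum_(n <- sval (cid (gcompP G v).2)) c n *: gcomp G n v.

Lemma rescale_funE v (r : seq int) :
  uniq r -> (forall n, n \notin r -> gcomp G n v = 0) ->
  rescale_fun v = \sum_(n <- r) c n *: gcomp G n v.
Proof.
move=> ur r0; rewrite /rescale_fun; case: cid => s /= [us s0 _].
have u1 := undup_uniq (s ++ r).
rewrite -(@big_supp _ _ s _ us u1) => [|n|n /s0 ->]; last exact: scaler0.
  rewrite (@big_supp _ _ r _ ur u1) // => [n|n /r0 ->]; last exact: scaler0.
  by rewrite mem_undup mem_cat orbC => ->.
by rewrite mem_undup mem_cat => ->.
Qed.

Fact rescale_fun_linear : linear rescale_fun.
Proof.
move=> a u v; have [_ [s [us s0 _]]] := gcompP G u.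
have [_ [r [ur r0 _]]] := gcompP G v.
have u1 := undup_uniq (s ++ r).
have s1 n : n \notin undup (s ++ r) -> gcomp G n u = 0.
  by rewrite mem_undup mem_cat negb_or => /andP[/s0].
have r1 n : n \notin undup (s ++ r) -> gcomp G n v = 0.
  by rewrite mem_undup mem_cat negb_or => /andP[_ /r0].
rewrite (rescale_funE u1 s1) (rescale_funE u1 r1).
rewrite (rescale_funE u1) => [|n nsr].
  rewrite scaler_sumr -big_split; apply: eq_bigr => n _ /=.
  by rewrite linearP scalerDr !scalerA mulrC.
by rewrite linearP /= s1 // r1 // scaler0 addr0.
Qed.

HB.instance Definition _ :=
  GRing.isLinear.Build k V V _ rescale_fun rescale_fun_linear.

Definition rescale : {linear V -> V} := rescale_fun.

Lemma rescale_homog n v : G n v -> rescale v = c n *: v.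
Proof.
move=> Gv; rewrite /rescale /= (@rescale_funE v [:: n]) // => [|m].
  by rewrite big_seq1 (gcomp_homog _ Gv) eqxx.
by rewrite inE (gcomp_homog _ Gv) => /negPf ->.
Qed.

End Rescale.

Lemma graded_ext (k : fieldType) (V W : lmodType k) (G : grading V)
    (f g : V -> W) :
  linear f -> linear g -> (forall n v, G n v -> f v = g v) -> f =1 g.
Proof.
move=> lf lg e v.
have l0 (h : V -> W) : linear h -> h 0 = 0.
  by move=> lh; have := lh (-1) 0 0; rewrite !scaleN1r !addNr.
elim: (grading_span G v) => [|a x w [n Gx] _ IH]; first by rewrite !l0.
by rewrite lf lg IH (e _ _ Gx).
Qed.

(** * Permuting tensor factors *)

Section Rotation.
Variable k : fieldType.

(** [evalr] evaluates the last factor, but DA stands in the middle of M ox DA ox N; exchanging the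
    last two factors brings it to the end. *)
Definition trot (U V W : lmodType k) :
    {linear tensor (tensor U V) W -> tensor (tensor U W) V} :=
  tmap (tswap W U) idfun \o tassoc W U V \o tswap (tensor U V) W.

Lemma trotE (U V W : lmodType k) (u : U) (v : V) (w : W) :
  trot U V W ((u \ox v) \ox w) = (u \ox w) \ox v.
Proof. by rewrite /trot /= tswapE tassocE tmapE tswapE. Qed.

Lemma trotK (U V W : lmodType k) : cancel (trot U V W) (trot U W V).
Proof.
elim/tensor_ind => [|x w t IH]; first by rewrite !linear0.
rewrite !linearD IH; congr (_ + _) => {t IH}.
elim/tensor_ind: x => [|u v t IH]; first by rewrite pure0l !linear0.
by rewrite pureDl !linearD IH !trotE.
Qed.

End Rotation.

Section Main.
Variables (k : fieldType) (A : grAlg k).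

(** * The cotensor product as a commutation condition *)

Section Cotensor.
Variables (M : lfLmod A) (N : lfRmod A).

Let D : lmodType k := dual A.

Lemma eval_coactr (x : tensor M N) a :
  evalr A _ (trot _ _ _ (tmap (coactr M) idfun x)) a = tlact a x.
Proof.
elim/tensor_ind: x => [|m n t IH]; first by rewrite tlact0 !linear0.
(* Writing a m as an evaluated coaction makes both sides additive in [coactr M m], so a second
   induction reduces to pure tensors. *)
rewrite !linearD tlactD fctE IH tlactE tmapE -coactrE; congr (_ + _).
elim/tensor_ind: (coactr M m) => [|u f s IHs].
  by rewrite linear0 !pure0l !linear0.
by rewrite pureDl !linearD !fctE pureDl IHs trotE !evalrE pureZl.
Qed.

Lemma eval_coactl (x : tensor M N) a :
  evalr A _ (trot _ _ _ (tassoc M D N (tmap idfun (coactl N) x))) a =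
  tract x a.
Proof.
elim/tensor_ind: x => [|m n t IH]; first by rewrite tract0 !linear0.
rewrite !linearD tractD fctE IH tractE tmapE -coactlE; congr (_ + _).
elim/tensor_ind: (coactl N n) => [|f u s IHs].
  by rewrite linear0 !pure0r !linear0.
rewrite pureDr !linearD !fctE pureDr IHs.
by rewrite tassocE trotE evalrE evallE pureZr.
Qed.

Lemma cotensor_map_eq0 (x : tensor M N) :
  cotensor_map x = 0 <-> forall a, tlact a x = tract x a.
Proof.
split=> [/eqP|h].
  by rewrite subr_eq0 => /eqP e a; rewrite -eval_coactr e eval_coactl.
apply/eqP; rewrite subr_eq0; apply/eqP.
apply: (can_inj (@trotK _ _ _ _)); apply: evalr_inj.
by apply/funext => a; rewrite eval_coactr eval_coactl.
Qed.

(** * The sign twist *)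

Variable p : int.

(** The Koszul sign for moving a map of degree [p] past an element of degree [i]. *)
Definition ksign (i : int) : k := (-1) ^ (p * i).

Lemma ksignD i j : ksign (i + j) = ksign i * ksign j.
Proof. by rewrite /ksign mulrDr expfzDr // oppr_eq0 oner_eq0. Qed.

Lemma ksign_sqr i : ksign i * ksign i = 1.
Proof. by rewrite -expfzMl mulrNN mulr1 exp1rz. Qed.

(** Only the degree of the left factor counts, so the twist commutes with the right action and meets
    the left action with a sign. *)
Definition twist : {linear tensor M N -> tensor M N} :=
  tmap (rescale (lm_gr M) ksign) idfun.

Lemma twist_homog i m n : lm_gr M i m -> twist (m \ox n) = ksign i *: (m \ox n).
Proof. by move=> Mm; rewrite tmapE (rescale_homog _ Mm) pureZl. Qed.

Lemma twistK : involutive twist.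
Proof.
elim/tensor_ind => [|m n t IH]; first by rewrite !linear0.
rewrite !linearD IH; congr (_ + _); rewrite !tmapE; congr (_ \ox _).
apply: (graded_ext (G := lm_gr M) (f := rescale _ _ \o rescale _ _) (g := id)) => //.
  by move=> a u v /=; rewrite !linearP.
move=> i v Mv /=; rewrite (rescale_homog _ Mv) linearZ /=.
by rewrite (rescale_homog _ Mv) scalerA ksign_sqr scale1r.
Qed.

Lemma twist_piece q x :
  tensor_grading (lm_gr M) (rm_gr N) q x ->
  tensor_grading (lm_gr M) (rm_gr N) q (twist x).
Proof.
elim=> [|a _ t [i [j [m [n [Mm Nn ij ->]]]]] _ IH].
  by rewrite linear0; apply: smem0.
rewrite linearP; apply: smem_lin => //.
rewrite [twist _](twist_homog _ Mm) -pureZl; apply: span_gen.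
exists i, j, (ksign i *: m), n; split=> //.
by rewrite -[_ *: _]addr0; apply: smem_lin (smem0 _).
Qed.

(** Acting by [a] raises the degree of the left factor by [i], and [ksign] is multiplicative. *)
Lemma twist_lact i a x : ga_gr A i a ->
  twist (tlact a x) = ksign i *: tlact a (twist x).
Proof.
move=> Aa; elim/tensor_ind: x => [|m n t IH].
  by rewrite linear0 tlact0 linear0 scaler0.
rewrite tlactD !linearD tlactD scalerDr IH tlactE; congr (_ + _).
rewrite !tmapE tlactE -pureZl; congr (_ \ox _).
have ll := act_linr (lm_act M) a.
apply: (graded_ext (G := lm_gr M) (f := rescale _ _ \o lact a)
  (g := fun m => ksign i *: lact a (rescale (lm_gr M) ksign m))).
- by move=> b u v /=; rewrite ll linearP.
- by move=> b u v /=; rewrite linearP ll scalerDr !scalerA mulrC.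
move=> j v Mv /=; rewrite (rescale_homog _ (act_deg (lm_act M) Aa Mv)).
by rewrite (rescale_homog _ Mv) ksignD -scalerA [lact a (_ *: _)]linearZ.
Qed.

Lemma twist_ract x a : twist (tract x a) = tract (twist x) a.
Proof.
elim/tensor_ind: x => [|m n t IH]; first by rewrite linear0 tract0 linear0.
by rewrite tractD !linearD tractD IH tractE !tmapE tractE.
Qed.

(** * Passing between cotensor elements and bimodule maps *)

Fact cotensor_hom x : cotensor M N p x ->
  bimod_hom (regular A) (tensor_bimod M N) p (tract (twist x)).
Proof.
move=> [px /cotensor_map_eq0 h]; split.
  split=> [|i a Aa]; first exact: (act_linl (tract_is_act M N)).
  exact: (act_deg (tract_is_act M N) Aa (twist_piece px)).
move=> i a b c Aa /=; rewrite !tractM -tlractC.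
(* With y = [twist x]: y a = twist (x a) = twist (a x) = (-1)^(p |a|) a y. *)
by rewrite -twist_ract -h (twist_lact _ Aa) /tract !linearZ.
Qed.

Fact hom_cotensor f : bimod_hom (regular A) (tensor_bimod M N) p f ->
  cotensor M N p (twist (f (gone A))).
Proof.
move=> [[lf df] hf]; split.
  by apply: twist_piece; have := df _ _ (gone_deg A); rewrite add0r.
(* The sign rule for [f] needs a homogeneous [a]; linearity in [a] allows this restriction. *)
apply/cotensor_map_eq0; apply: (graded_ext (G := ga_gr A)).
- exact: (act_linl (tlact_is_act M N)).
- exact: (act_linl (tract_is_act M N)).
move=> i a Aa; rewrite -twist_ract.
(* With 1, of degree 0, as left factor no sign appears: f(a) = f(1) a. *)
have /= := hf _ _ (gone A) a (gone_deg A).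
rewrite mulr0 expr0z scale1r !gmul1l tlractC.
rewrite (act_one (tlact_is_act M N)) => <-.
(* With [a] as left factor, f(a) = (-1)^(p |a|) a f(1). *)
have /= := hf _ _ (gone A) (gone A) Aa.
rewrite !gmul1r (act_one (tract_is_act M N)) => ->.
(* The sign from [f] cancels the one from the twist. *)
rewrite -/(ksign i) linearZ /= (twist_lact _ Aa).
by rewrite scalerA ksign_sqr scale1r.
Qed.

Definition cotensor_to_hom (x : subm_type (cotensor M N p)) :
    subm_type (bimod_hom (regular A) (tensor_bimod M N) p) :=
  insubm (cotensor_hom (subm_typeP x)).

Fact cotensor_to_hom_linear : linear cotensor_to_hom.
Proof.
move=> a x y; apply/val_inj/funext => b.
rewrite linearP /= !fctE linearP; exact: (act_linr (tract_is_act M N)).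
Qed.
HB.instance Definition _ :=
  GRing.isLinear.Build k _ _ _ cotensor_to_hom cotensor_to_hom_linear.

(** The inverse evaluates at 1 and twists; it recovers [f] because f(a) = f(1) a. *)
Lemma cotensor_to_hom_bij : bijective cotensor_to_hom.
Proof.
exists (fun f => insubm (hom_cotensor (subm_typeP f))) => [x|f].
  by apply/val_inj; rewrite /= (act_one (tract_is_act M N)) twistK.
apply/val_inj/funext => a /=; rewrite twistK.
have [_ /(_ _ _ (gone A) a (gone_deg A))] := subm_typeP f.
rewrite /= mulr0 expr0z scale1r !gmul1l tlractC => ->.
by rewrite (act_one (tlact_is_act M N)).
Qed.

End Cotensor.

(** [f] preserves degrees, hence the signs. *)
Lemma twist_nat (M M' : lfLmod A) (N N' : lfRmod A) (f : lmodMor M M')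
    (g : rmodMor N N') p x :
  twist M' N' p (tmap f g x) = tmap f g (twist M N p x).
Proof.
elim/tensor_ind: x => [|m n t IH]; first by rewrite !linear0.
rewrite !linearD IH !tmapE; congr (_ \ox _ + _).
apply: (graded_ext (G := lm_gr M) (f := rescale _ _ \o f)
  (g := f \o rescale _ _)) => [b u v|b u v|i v Mv] /=; rewrite ?linearP //.
rewrite (rescale_homog _ Mv) linearZ /=.
exact/rescale_homog/lmodMor_deg.
Qed.

End Main.

Unset Implicit Arguments.
Set Strict Implicit.

Theorem proposition5p2 (k : fieldType) (A : grAlg k)
    (A_nonneg : nonneg_graded A) (A_finite_type : finite_type A) :
  exists phi : forall (M : lfLmod A) (N : lfRmod A) (p : int),
      {linear subm_type (cotensor M N p) ->
              subm_type (bimod_hom (regular A) (tensor_bimod M N) p)},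
    (forall M N p, bijective (phi M N p)) /\
    (forall (M M' : lfLmod A) (N N' : lfRmod A)
        (f : lmodMor M M') (g : rmodMor N N') (p : int)
        (x : subm_type (cotensor M N p)),
      phi M' N' p (cotensor_mor f g x) =
      bimod_hom_map (tensor_bimodMor f g) (phi M N p x)).
Proof.
exists (fun M N p => @cotensor_to_hom k A M N p); split=> [M N p|].
  exact: cotensor_to_hom_bij.
move=> M M' N N' f g p x; apply/val_inj/funext => a /=.
(* At each [a], what remains is that f ox g respects the right action. *)
rewrite twist_nat; exact: esym (tensor_bimodMor_ract f g _ a).
Qed.
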